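(* Let $M$ be a smooth manifold and let $\varphi$ be a generalized polynomial structure on $M$. Then: (i) for all $\lambda\in\Sigma(\varphi)\setminus\{0\}$, the bundle $L_\lambda$ is isotropic; (ii) for all $\lambda\in\Sigma(\varphi)\setminus\{0\}$, the bundle $E_\lambda:=L_\lambda\oplus L_{-\lambda}$ is a quasi split structure; (iii) the bundle $E_0:=L_0$ is a quasi split structure; (iv) the bundle $\mathbb{T}M\otimes\mathbb{C}$ splits as the orthogonal direct sum $$\mathbb{T}M\otimes\mathbb{C}=E_0\oplus\bigoplus_{\lambda\in\Sigma_+(\varphi)}E_\lambda .$$
   Context: $\mathbb{T}M=TM\oplus T^*M$ is the generalized tangent bundle with the tautological inner product $\langle X+\alpha,Y+\beta\rangle=\frac12(\alpha(Y)+\beta(X))$, extended $\mathbb{C}$-bilinearly to $\mathbb{T}M\otimes\mathbb{C}$. A subbundle is isotropic if the inner product vanishes identically on it; ''orthogonal'' refers to this inner product. A skew-symmetric endomorphism of $\mathbb{T}M$ is a ($C^\infty(M)$-linear) bundle endomorphism $\varphi$ with $\langle\varphi(\mathbf{x}),\mathbf{y}\rangle+\langle\mathbf{x},\varphi(\mathbf{y})\rangle=0$. A generalized polynomial structure is a skew-symmetric endomorphism $\varphi$ of $\mathbb{T}M$ for which there is a monic polynomial $P(x)\in\mathbb{R}[x]$ of positive degree that is the minimal polynomial of $\varphi_p:\mathbb{T}_pM\to\mathbb{T}_pM$ for every $p\in M$; $P$ is called the minimal polynomial of $\varphi$. $\Sigma(\varphi)\subset\mathbb{C}$ is the set of eigenvalues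 of $\varphi$ (roots of $P$), and $m(\lambda)$ is the multiplicity of $\lambda$ as a root of $P$. $L_\lambda={\rm Ker}((\varphi-\lambda I)^{m(\lambda)})\subseteq\mathbb{T}M\otimes\mathbb{C}$ is the generalized eigenbundle with eigenvalue $\lambda$ ($L_\lambda=0$ if $\lambda\notin\Sigma(\varphi)$). $\Sigma(\varphi)$ is symmetric about $0$; $\Sigma_+(\varphi)\subset\Sigma(\varphi)$ is any fixed subset such that $\Sigma_+(\varphi)$ and $-\Sigma_+(\varphi)$ partition $\Sigma(\varphi)\setminus\{0\}$. A quasi split structure is a subbundle $E\subseteq\mathbb{T}M\otimes\mathbb{C}$ such that the restriction of the tautological inner product to $E$ is non-degenerate and each fiber of $E$ is the direct sum of two isotropic subspaces. *)

(* Defs.v *)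
From HB Require Import structures.
From mathcomp Require Import all_boot all_order all_algebra finmap.
From mathcomp Require Import all_classical all_reals all_analysis.
From mathcomp Require Import complex.

Set Implicit Arguments.
Unset Strict Implicit.
Unset Printing Implicit Defensive.

Import Order.TTheory GRing.Theory Num.Theory numFieldNormedType.Exports.

Local Open Scope ring_scope.
Local Open Scope classical_set_scope.

(* [f] is of class C^k on [V]; only used for open [V]. *)
Fixpoint class_C (R : realType) (n : nat) (W : normedModType R) (k : nat)
    (V : set 'rV[R]_n) (f : 'rV[R]_n -> W) : Prop :=
  if k is k'.+1 then
    (forall x, V x -> differentiable f x) /\
    (forall v : 'rV[R]_n, class_C k' V (fun x => 'd f x v))
  else forall x, V x -> {for x, continuous f}.

Definition smooth_on (R : realType) (n : nat) (W : normedModType R)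
    (V : set 'rV[R]_n) (f : 'rV[R]_n -> W) : Prop :=
  forall k, class_C k V f.

(* [chart_inv] is only meaningful on the image of [chart_dom]. *)
Record chart (R : realType) (n : nat) (T : topologicalType) := Chart {
  chart_map :> T -> 'rV[R]_n;
  chart_inv : 'rV[R]_n -> T;
  chart_dom : set T;
  chart_dom_open : open chart_dom;
  chart_codom_open : open (chart_map @` chart_dom);
  chart_mapK : forall p, chart_dom p -> chart_inv (chart_map p) = p;
  chart_map_continuous : forall p, chart_dom p -> {for p, continuous chart_map};
  chart_inv_continuous : forall p, chart_dom p ->
    {for chart_map p, continuous chart_inv} }.

Definition transition (R : realType) (n : nat) (T : topologicalType)
    (a b : chart R n T) : 'rV[R]_n -> 'rV[R]_n :=
  fun x => b (chart_inv a x).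

(* The atlas need not be maximal.  [chart_at] selects a chart around each
   point; it serves only to fix coordinates on the fibers of [TM]. *)
Record manifold (R : realType) (n : nat) := Manifold {
  carrier :> topologicalType;
  manifold_hausdorff : hausdorff_space carrier;
  manifold_second_countable : @second_countable carrier;
  atlas : set (chart R n carrier);
  chart_at : carrier -> chart R n carrier;
  chart_at_atlas : forall p, atlas (chart_at p);
  chart_at_dom : forall p, chart_dom (chart_at p) p;
  transition_smooth : forall a b, atlas a -> atlas b ->
    smooth_on (a @` (chart_dom a `&` chart_dom b)) (transition a b) }.

(* The fiber at [p] of the generalized tangent bundle is 'rV[R]_(n + n): the
   row [row_mx X alpha] stands for the pair of the vector with components [X]
   and the covector with components [alpha] in the coordinates
   [x := chart_at p], i.e. in the bases (d/dx_j) and (dx_j) at [p].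
   Right multiplication by [frame a p] gives the components of the same pair
   in the coordinates [a]: vectors are transformed by the Jacobian [J] of the
   change of coordinates (acting on rows) and covectors contragrediently. *)
Definition frame (R : realType) (n : nat) (M : manifold R n)
    (a : chart R n M) (p : M) : 'M[R]_(n + n) :=
  let J := 'J (transition (chart_at p) a) (chart_at p p) in
  block_mx J 0 0 (invmx J)^T.

(* Smoothness around [p] of a field given by its matrix [F a q] of components
   at [q] in the coordinates [a].  One chart of the atlas suffices when
   [F] follows the tensorial change of coordinates. *)
Definition smooth_components (R : realType) (n : nat) (M : manifold R n)
    (p : M) (m1 m2 : nat) (F : chart R n M -> M -> 'M[R]_(m1, m2)) : Prop :=
  exists a : chart R n M, [/\ atlas a, chart_dom a p &
    exists2 V : set 'rV[R]_n, open_nbhs (a p) V &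
      forall i j, smooth_on V (fun x => F a (chart_inv a x) i j)].

(* The rows of [s] are sections of the generalized tangent bundle. *)
Definition smooth_sections (R : realType) (n : nat) (M : manifold R n)
    (k : nat) (s : M -> 'M[R]_(k, n + n)) (p : M) : Prop :=
  smooth_components p (fun a q => s q *m frame a q).

(* The complexified fiber is 'rV[R[i]]_(n + n). *)
Definition smooth_csections (R : realType) (n : nat) (M : manifold R n)
    (k : nat) (s : M -> 'M[R[i]]_(k, n + n)) (p : M) : Prop :=
  smooth_sections (fun q => map_mx (@complex.Re R) (s q)) p /\
  smooth_sections (fun q => map_mx (@complex.Im R) (s q)) p.

(* A bundle endomorphism is a field of matrices [phi p] acting on the rows of
   the fiber by [x |-> x *m phi p]. *)
Definition smooth_endo (R : realType) (n : nat) (M : manifold R n)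
    (phi : M -> 'M[R]_(n + n)) : Prop :=
  forall p, smooth_components p
    (fun a q => invmx (frame a q) *m phi q *m frame a q).

(* <X + alpha, Y + beta> = 1/2 (alpha(Y) + beta(X)); over R[i] this is the
   bilinear (not sesquilinear) extension. *)
Definition inner (F : fieldType) (n : nat) (x y : 'rV[F]_(n + n)) : F :=
  2^-1 * ((rsubmx x *m (lsubmx y)^T) 0 0 + (rsubmx y *m (lsubmx x)^T) 0 0).

(* Subspaces of a fiber are row spaces of square matrices. *)
Definition orthogonal_mx (F : fieldType) (n : nat) (A B : 'M[F]_(n + n)) :=
  forall x y : 'rV[F]_(n + n), (x <= A)%MS -> (y <= B)%MS -> inner x y = 0.

Definition isotropic_mx (F : fieldType) (n : nat) (A : 'M[F]_(n + n)) :=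
  orthogonal_mx A A.

Definition nondegenerate_mx (F : fieldType) (n : nat) (A : 'M[F]_(n + n)) :=
  forall x : 'rV[F]_(n + n), (x <= A)%MS ->
    (forall y : 'rV[F]_(n + n), (y <= A)%MS -> inner x y = 0) -> x = 0.

(* [E p] has a smooth local frame around every point.  Its rank is therefore
   locally constant; it may differ between components of [M]. *)
Definition subbundle (R : realType) (n : nat) (M : manifold R n)
    (E : M -> 'M[R[i]]_(n + n)) : Prop :=
  forall p0 : M, exists (k : nat) (s : M -> 'M[R[i]]_(k, n + n)) (U : set M),
    open_nbhs p0 U /\
    (forall p, U p ->
       [/\ row_free (s p), (s p :=: E p)%MS & smooth_csections s p]).

Definition isotropic_bundle (R : realType) (n : nat) (M : manifold R n)
    (E : M -> 'M[R[i]]_(n + n)) : Prop :=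
  subbundle E /\ forall p, isotropic_mx (E p).

Definition quasi_split (R : realType) (n : nat) (M : manifold R n)
    (E : M -> 'M[R[i]]_(n + n)) : Prop :=
  [/\ subbundle E,
      forall p, nondegenerate_mx (E p) &
      forall p, exists A B : 'M[R[i]]_(n + n),
        [/\ isotropic_mx A, isotropic_mx B,
            mxdirect (A + B)%MS & (A + B :=: E p)%MS]].

(* [horner_mx] only covers matrices of nonzero size. *)
Definition eval_mx (F : fieldType) (N : nat) (A : 'M[F]_N) (Q : {poly F}) :
    'M[F]_N := \sum_(i < size Q) Q`_i *: A ^+ i.

Definition is_minpoly (F : fieldType) (N : nat) (A : 'M[F]_N) (P : {poly F}) :=
  [/\ P \is monic, eval_mx A P = 0 &
      forall Q : {poly F}, Q \is monic -> eval_mx A Q = 0 ->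
        (size P <= size Q)%N].

Definition skew_endo (R : realType) (n : nat) (M : manifold R n)
    (phi : M -> 'M[R]_(n + n)) : Prop :=
  forall p (x y : 'rV[R]_(n + n)),
    inner (x *m phi p) y + inner x (y *m phi p) = 0.

Definition generalized_polynomial_structure (R : realType) (n : nat)
    (M : manifold R n) (phi : M -> 'M[R]_(n + n)) (P : {poly R}) : Prop :=
  [/\ smooth_endo phi, skew_endo phi, P \is monic, (1 < size P)%N &
      forall p, is_minpoly (phi p) P].

Definition cpoly (R : realType) (P : {poly R}) : {poly R[i]} :=
  map_poly (real_complex R) P.

Definition spectrum (R : realType) (P : {poly R}) : set R[i] :=
  [set l | root (cpoly P) l].

Definition eigenbundle (R : realType) (n : nat) (M : manifold R n)
    (phi : M -> 'M[R]_(n + n)) (P : {poly R}) (l : R[i]) (p : M) :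
    'M[R[i]]_(n + n) :=
  kermx ((map_mx (real_complex R) (phi p) - l%:M) ^+ mup l (cpoly P)).

Definition eigenbundle_pair (R : realType) (n : nat) (M : manifold R n)
    (phi : M -> 'M[R]_(n + n)) (P : {poly R}) (l : R[i]) (p : M) :
    'M[R[i]]_(n + n) :=
  (eigenbundle phi P l p + eigenbundle phi P (- l) p)%MS.

Definition half_spectrum (R : realType) (P : {poly R}) (S : {fset R[i]}) :=
  let S1 : set R[i] := [set` S] in
  S1 `|` (-%R @` S1) = spectrum P `\ 0 /\ S1 `&` (-%R @` S1) = set0.

(* Main.v *)
(** Write the complexified endomorphism as a matrix [A] killed by the minimal
    polynomial [p].  For each [l] there is a polynomial [e l] congruent to 1
    modulo [(X - l)^m(l)] and to 0 modulo the rest of [p]; the matrices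
    [e l (A)] are the projections onto the generalized eigenspaces.  Since the
    [e l] do not depend on the point and [A] is smooth, so are the projections,
    and a smooth field of idempotents has locally constant rank and smooth local
    frames.  Skewness turns [(A - l)^k] into [(-1)^k (A + l)^k] across the
    inner product, and [A + l] is invertible on [L_m] unless [m = -l], so [L_l]
    is orthogonal to [L_m] unless [l + m = 0]; nondegeneracy of the summands
    follows.  For odd [k >= m(0)] the form [<x A^k, y>] is alternating, so the
    rank of [A^k] is even, hence so is the dimension of [L_0], and a
    nondegenerate quadratic space of even dimension over an algebraically closed
    field is the sum of two isotropic subspaces. *)

Require Import Defs.
From HB Require Import structures.
From mathcomp Require Import all_boot all_order all_algebra finmap.
From mathcomp Require Import all_classical all_reals all_analysis.
From mathcomp Require Import complex.
Set Implicit Arguments.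
Unset Strict Implicit.
Unset Printing Implicit Defensive.
Import Order.TTheory GRing.Theory Num.Theory numFieldNormedType.Exports.
Local Open Scope ring_scope.
Local Open Scope classical_set_scope.

(** * Generalized eigenspaces *)

Lemma eval_mx_horner (F : fieldType) (N : nat) (A : 'M[F]_N.+1) (Q : {poly F}) :
  eval_mx A Q = horner_mx A Q.
Proof.
rewrite /eval_mx -[in RHS](coefK Q) poly_def raddf_sum /=.
by apply: eq_bigr => i _; rewrite horner_mxZ rmorphXn /= horner_mx_X.
Qed.

(** Settles size zero in the rules for [eval_mx]; in positive size they come from the ring morphism
    [horner_mx A]. *)
Lemma mx00_eq (F : fieldType) (A B : 'M[F]_0) : A = B.
Proof. by rewrite [A]flatmx0 [B]flatmx0. Qed.

Lemma eval_mxC (F : fieldType) (N : nat) (A : 'M[F]_N) (c : F) :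
  eval_mx A c%:P = c%:M.
Proof. by case: N A => [|N] A; [exact: mx00_eq | rewrite eval_mx_horner horner_mx_C]. Qed.

Lemma eval_mx1 (F : fieldType) (N : nat) (A : 'M[F]_N) : eval_mx A 1 = 1%:M.
Proof. exact: eval_mxC. Qed.

Lemma eval_mx0 (F : fieldType) (N : nat) (A : 'M[F]_N) : eval_mx A 0 = 0.
Proof. by rewrite -polyC0 eval_mxC raddf0. Qed.

Lemma eval_mxX (F : fieldType) (N : nat) (A : 'M[F]_N) : eval_mx A 'X = A.
Proof. by case: N A => [|N] A; [exact: mx00_eq | rewrite eval_mx_horner horner_mx_X]. Qed.

Lemma eval_mxD (F : fieldType) (N : nat) (A : 'M[F]_N) (Q1 Q2 : {poly F}) :
  eval_mx A (Q1 + Q2) = eval_mx A Q1 + eval_mx A Q2.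
Proof. by case: N A => [|N] A; [exact: mx00_eq | rewrite !eval_mx_horner rmorphD]. Qed.

Lemma eval_mxB (F : fieldType) (N : nat) (A : 'M[F]_N) (Q1 Q2 : {poly F}) :
  eval_mx A (Q1 - Q2) = eval_mx A Q1 - eval_mx A Q2.
Proof. by case: N A => [|N] A; [exact: mx00_eq | rewrite !eval_mx_horner rmorphB]. Qed.

Lemma eval_mxM (F : fieldType) (N : nat) (A : 'M[F]_N) (Q1 Q2 : {poly F}) :
  eval_mx A (Q1 * Q2) = eval_mx A Q1 *m eval_mx A Q2.
Proof. by case: N A => [|N] A; [exact: mx00_eq | rewrite !eval_mx_horner rmorphM]. Qed.

Lemma eval_mxXn (F : fieldType) (N : nat) (A : 'M[F]_N) (Q : {poly F}) (k : nat) :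
  eval_mx A (Q ^+ k) = eval_mx A Q ^+ k.
Proof. by case: N A => [|N] A; [exact: mx00_eq | rewrite !eval_mx_horner rmorphXn]. Qed.

Lemma eval_mx_sum (F : fieldType) (N : nat) (A : 'M[F]_N) (I : Type) (r : seq I)
    (B : pred I) (Q : I -> {poly F}) :
  eval_mx A (\sum_(i <- r | B i) Q i) = \sum_(i <- r | B i) eval_mx A (Q i).
Proof. exact: (big_morph _ (eval_mxD A) (eval_mx0 A)). Qed.

Lemma eval_mx_dvd (F : fieldType) (N : nat) (A : 'M[F]_N) (Q1 Q2 : {poly F}) :
  Q1 %| Q2 -> eval_mx A Q1 = 0 -> eval_mx A Q2 = 0.
Proof. by move=> /dvdpP[Q ->] Q1A; rewrite eval_mxM Q1A mulmx0. Qed.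

Lemma eval_mx_map (F F' : fieldType) (f : {rmorphism F -> F'}) (N : nat)
    (A : 'M[F]_N) (Q : {poly F}) :
  eval_mx (map_mx f A) (map_poly f Q) = map_mx f (eval_mx A Q).
Proof.
case: N A => [|N] A; first exact: mx00_eq.
by rewrite !eval_mx_horner map_horner_mx.
Qed.

Lemma eval_mx_conj (F : fieldType) (N : nat) (A B : 'M[F]_N) (Q : {poly F}) :
  B \in unitmx ->
  eval_mx (invmx B *m A *m B) Q = invmx B *m eval_mx A Q *m B.
Proof.
case: N A B => [|N] A B Bu; first exact: mx00_eq.
by rewrite !eval_mx_horner horner_mx_uconjC.
Qed.

(** Write [p] as [d] times its gcd with [f]. At a root of [d] the gcd would have smaller
    multiplicity than [p], although it is divisible by the full power occurring in [p]; so [d] has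
    no root and is constant. *)
Lemma closed_dvdp_mup (F : closedFieldType) (p f : {poly F}) :
  p != 0 -> (forall x, root p x -> ('X - x%:P) ^+ mup x p %| f) -> p %| f.
Proof.
move=> p0 pf.
have [/dvdpP[d pE] gf] : gcdp p f %| p /\ gcdp p f %| f.
  by rewrite dvdp_gcdl dvdp_gcdr.
have := p0; rewrite {1}pE mulf_eq0 negb_or => /andP[d0 g0].
have [/closed_rootP[x dx]|d1] := boolP (size d != 1).
  have px : root p x by rewrite pE rootM dx.
  have : ('X - x%:P) ^+ mup x p %| gcdp p f.
    by rewrite dvdp_gcd pf // andbT -mup_geq.
  rewrite -mup_geq // {1}pE mupM // -{2}[mup x (gcdp p f)]add0n leq_add2r leqn0.
  by rewrite -leqn0 leqNgt -XsubC_dvd // dvdp_XsubCl dx.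
move: d1; rewrite negbK => /size_poly1P[c c0 dE].
by apply: dvdp_trans gf; rewrite {1}pE dE mul_polyC dvdpZl.
Qed.

(* At a matrix annihilated by [p], such an [e] evaluates to the projection onto
   the generalized eigenspace of [l]. *)
Definition is_eigenproj (F : fieldType) (p : {poly F}) (l : F) (e : {poly F}) :=
  (p %| e * ('X - l%:P) ^+ mup l p) /\ (('X - l%:P) ^+ mup l p %| 1 - e).

Lemma coprimep_XsubCX (F : fieldType) (x y : F) (i j : nat) :
  x != y -> coprimep (('X - x%:P) ^+ i) (('X - y%:P) ^+ j).
Proof.
move=> xy; apply: coprimep_expl; apply: coprimep_expr.
by rewrite coprimep_XsubC2 // subr_eq0 eq_sym.
Qed.

(** If [X - l] divided the cofactor, its multiplicity in [p] would be larger. The exponent [k] is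
    free so that powers beyond the multiplicity are covered. *)
Lemma coprimep_cofactor (F : fieldType) (p : {poly F}) (l : F) (k : nat) :
  p != 0 -> coprimep (('X - l%:P) ^+ k) (p %/ ('X - l%:P) ^+ mup l p).
Proof.
move=> p0; apply: coprimep_expl; rewrite coprimep_sym coprimep_XsubC.
have pE : ('X - l%:P) ^+ mup l p %| p by rewrite -mup_geq.
apply/negP; rewrite -dvdp_XsubCl => /(dvdp_mul (dvdpp (('X - l%:P) ^+ mup l p))).
by rewrite [X in _ %| X]mulrC divpK // -exprSr -mup_geq // ltnn.
Qed.

Lemma eigenproj_exists (F : fieldType) (p : {poly F}) :
  p != 0 -> exists e : F -> {poly F}, forall l, is_eigenproj p l (e l).
Proof.
move=> p0; suff /boolp.choice[e pe] : forall l, exists e, is_eigenproj p l e by exists e.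
move=> l; have pE : ('X - l%:P) ^+ mup l p %| p by rewrite -mup_geq.
have /Bezout_eq1_coprimepP[[u v] /= uvE] := coprimep_cofactor l (mup l p) p0.
(* The cofactor term of the Bezout identity. When [l] is not a root, the multiplicity is 0 and the
   cofactor is [p], so the projection is zero. *)
exists (v * (p %/ ('X - l%:P) ^+ mup l p)); split.
  by rewrite -mulrA divpK // dvdp_mull.
by rewrite -uvE addrK dvdp_mull.
Qed.

Lemma eigenproj_dvd (F : fieldType) (p : {poly F}) (l x : F) (e : {poly F}) :
  p != 0 -> is_eigenproj p l e -> x != l -> ('X - x%:P) ^+ mup x p %| e.
Proof.
move=> p0 [pe _] xl.
rewrite -(Gauss_dvdpl _ (coprimep_XsubCX (mup x p) (mup l p) xl)).
by apply: dvdp_trans pe; rewrite -mup_geq.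
Qed.

(** At each root [x] of [p] one factor carries the whole power of [X - x]: [e] if [x] is not [l],
    and [f] if it is. *)
Lemma eigenproj_orth (F : closedFieldType) (p : {poly F}) (l m : F)
    (e f : {poly F}) :
  p != 0 -> is_eigenproj p l e -> is_eigenproj p m f -> l != m -> p %| e * f.
Proof.
move=> p0 pe pf lm; apply: closed_dvdp_mup => // x _.
have [xl|xl] := eqVneq x l; last exact/dvdp_mulr/(eigenproj_dvd p0 pe).
by rewrite dvdp_mull // (eigenproj_dvd p0 pf) // xl.
Qed.

(** At a root [x], the full power of [X - x] divides [1 - e x] and every [e l] with [l] different
    from [x]. *)
Lemma eigenproj_sum (F : closedFieldType) (p : {poly F}) (e : F -> {poly F})
    (s : seq F) :
  p != 0 -> (forall l, is_eigenproj p l (e l)) -> uniq s ->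
  (forall x, (x \in s) = root p x) -> p %| 1 - \sum_(l <- s) e l.
Proof.
move=> p0 pe s_uniq ps; apply: closed_dvdp_mup => // x; rewrite -ps => xs.
rewrite (bigD1_seq x) //= opprD addrA dvdp_sub //; first by case: (pe x).
apply: (big_ind (fun f => _ %| f)) => [|f g|l lx]; [exact: dvdp0|exact: dvdp_add|].
by apply: eigenproj_dvd (pe l) _; rewrite // eq_sym.
Qed.

Lemma closed_roots_seq (F : closedFieldType) (p : {poly F}) :
  p != 0 -> exists2 s : seq F, uniq s & forall x, (x \in s) = root p x.
Proof.
move=> p0; have [r pE] := closed_field_poly_normal p.
exists (undup r); first exact: undup_uniq.
by move=> x; rewrite pE rootZ ?lead_coef_eq0 // root_prod_XsubC mem_undup.
Qed.

Definition primary_space (F : fieldType) (N : nat) (A : 'M[F]_N) (p : {poly F})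
  (l : F) : 'M[F]_N := kermx ((A - l%:M) ^+ mup l p).

Lemma eval_mx_XsubCX (F : fieldType) (N : nat) (A : 'M[F]_N) (l : F) (k : nat) :
  eval_mx A (('X - l%:P) ^+ k) = (A - l%:M) ^+ k.
Proof. by rewrite eval_mxXn eval_mxB eval_mxX eval_mxC. Qed.


(** [1 - e] is a multiple of the power that kills the generalized eigenspace; conversely [e] times
    that power is a multiple of [p]. *)
Lemma sub_primary_space (F : fieldType) (N m : nat) (A : 'M[F]_N) (p e : {poly F})
    (l : F) (x : 'M[F]_(m, N)) :
  eval_mx A p = 0 -> is_eigenproj p l e ->
  (x <= primary_space A p l)%MS = (x *m eval_mx A e == x).
Proof.
move=> pA [pe e1]; apply/sub_kermxP/eqP => [xA|<-].
  case/dvdpP: e1 => q /eqP; rewrite subr_eq => /eqP e1.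
  by rewrite -[RHS]mulmx1 -(eval_mx1 A) e1 mulrC eval_mxD eval_mxM mulmxDr
             mulmxA eval_mx_XsubCX xA mul0mx add0r.
by rewrite -mulmxA -eval_mx_XsubCX -eval_mxM (eval_mx_dvd pe) ?mulmx0.
Qed.

Lemma primary_spaceE (F : fieldType) (N : nat) (A : 'M[F]_N) (p e : {poly F})
    (l : F) :
  eval_mx A p = 0 -> is_eigenproj p l e ->
  (primary_space A p l :=: eval_mx A e)%MS.
Proof.
move=> pA pe; apply/eqmxP/andP; split.
  apply/rV_subP => x; rewrite (sub_primary_space _ pA pe) => /eqP <-.
  exact: submxMl.
by apply/sub_kermxP; rewrite -eval_mx_XsubCX -eval_mxM (eval_mx_dvd (proj1 pe)).
Qed.

(** The kernels are stationary from the multiplicity on, since the cofactor of [p] is coprime to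
    every power of [X - l]. This allows an odd exponent in the parity argument at 0. *)
Lemma primary_space_pow (F : fieldType) (N : nat) (A : 'M[F]_N) (p : {poly F})
    (l : F) (k : nat) :
  p != 0 -> eval_mx A p = 0 -> (mup l p <= k)%N ->
  (primary_space A p l :=: kermx ((A - l%:M) ^+ k))%MS.
Proof.
move=> p0 pA mk; apply/eqmxP/andP; split.
  apply/sub_kermxP; rewrite -eval_mx_XsubCX -(subnKC mk) exprD eval_mxM mulmxA.
  by rewrite eval_mx_XsubCX mulmx_ker mul0mx.
have /Bezout_eq1_coprimepP[[u v] /= uvE] := coprimep_cofactor l k p0.
have pE : ('X - l%:P) ^+ mup l p %| p by rewrite -mup_geq.
apply/sub_kermxP; set K := kermx _.
have KA : K *m eval_mx A (('X - l%:P) ^+ k) = 0 by rewrite eval_mx_XsubCX mulmx_ker.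
rewrite -eval_mx_XsubCX -[K]mulmx1 -(eval_mx1 A) -uvE [u * _]mulrC eval_mxD.
rewrite !eval_mxM mulmxDr mulmxA KA mul0mx add0r -!mulmxA.
rewrite -[_ *m eval_mx A (_ ^+ _)]eval_mxM.
by rewrite divpK // pA !mulmx0.
Qed.

(** * Skew maps for a symmetric bilinear form *)

Definition gram (F : fieldType) (n : nat) : 'M[F]_(n + n) :=
  2^-1 *: block_mx 0 1%:M 1%:M 0.

Lemma innerE (F : fieldType) (n : nat) (x y : 'rV[F]_(n + n)) :
  inner x y = (x *m gram F n *m y^T) 0 0.
Proof.
rewrite /inner /gram -scalemxAr -scalemxAl [RHS]mxE; congr (_ * _).
rewrite -[x in RHS]hsubmxK -[y in RHS]hsubmxK mul_row_block tr_row_mx mul_row_col.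
rewrite !mulmx0 !mulmx1 add0r addr0 [RHS]mxE; congr (_ + _).
by rewrite -[LHS]trace_mx11 -[RHS]trace_mx11 -mxtrace_tr trmx_mul trmxK.
Qed.

Lemma orthogonal_mxP (F : fieldType) (n : nat) (A B : 'M[F]_(n + n)) :
  orthogonal_mx A B <-> A *m gram F n *m B^T = 0.
Proof.
split=> [AB|AB x y /submxP[a ->] /submxP[b ->]].
  apply/matrixP => i j; rewrite [RHS]mxE -(AB _ _ (row_sub i A) (row_sub j B)).
  rewrite innerE -row_mul [LHS]mxE [RHS]mxE.
  by apply: eq_bigr => k _; rewrite [RHS]mulrC !mxE mulrC.
rewrite innerE trmx_mul !mulmxA -3!mulmxA (mulmxA A) (mulmxA _ B^T) AB.
by rewrite mul0mx mulmx0 mxE.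
Qed.

Lemma gram_sym (F : fieldType) (n : nat) : (gram F n)^T = gram F n.
Proof. by rewrite /gram linearZ /= tr_block_mx !trmx0 !trmx1. Qed.

Lemma gram_unit (F : numFieldType) (n : nat) : gram F n \in unitmx.
Proof.
rewrite unitmxZ ?unitfE ?invr_eq0 ?pnatr_eq0 //.
pose J : 'M[F]_(n + n) := block_mx 0 1%:M 1%:M 0.
suff /mulmx1_unit[] : J *m J = 1%:M by [].
by rewrite /J mulmx_block !mulmx0 !mul0mx !mulmx1 !addr0 !add0r -scalar_mx_block.
Qed.

Lemma map_gram (F F' : fieldType) (f : {rmorphism F -> F'}) (n : nat) :
  map_mx f (gram F n) = gram F' n.
Proof.
rewrite /gram map_mxZ map_block_mx !map_mx0 !map_mx1.
by rewrite fmorphV rmorph_nat.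
Qed.

(* A linear map is skew for the bilinear form with Gram matrix [G]. *)
Definition skew_for (F : fieldType) (N : nat) (G A : 'M[F]_N) :=
  A *m G = - (G *m A^T).

Lemma skew_for_inner (F : fieldType) (n : nat) (A : 'M[F]_(n + n)) :
  (forall x y : 'rV[F]_(n + n), inner (x *m A) y + inner x (y *m A) = 0) ->
  skew_for (gram F n) A.
Proof.
move=> Askew; apply/eqP; rewrite -addr_eq0; apply/eqP/matrixP => i j.
have dE (X : 'M[F]_(n + n)) :
    ((delta_mx 0 i : 'rV_(n + n)) *m X *m (delta_mx 0 j : 'rV_(n + n))^T) 0 0 = X i j.
  by rewrite -rowE trmx_delta -colE !mxE.
rewrite [RHS]mxE -(Askew (delta_mx 0 i) (delta_mx 0 j)) !innerE trmx_mul.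
by rewrite !mulmxA -(mulmxA _ A) -(mulmxA _ _ A^T) !dE mxE.
Qed.

Lemma skew_for_map (F F' : fieldType) (f : {rmorphism F -> F'}) (N : nat)
    (G A : 'M[F]_N) :
  skew_for G A -> skew_for (map_mx f G) (map_mx f A).
Proof. by rewrite /skew_for -map_mxM => ->; rewrite map_mxN map_mxM map_trmx. Qed.

Lemma skew_for_pow (F : fieldType) (N : nat) (G A : 'M[F]_N) (l : F) (k : nat) :
  skew_for G A ->
  G *m ((A + l%:M) ^+ k)^T = (-1) ^+ k *: ((A - l%:M) ^+ k *m G).
Proof.
move=> AG; elim: k => [|k IHk].
  by rewrite !expr0 scale1r trmx1 mulmx1 mul1mx.
rewrite exprSr [trmx (_ * _)]trmx_mul linearD /= tr_scalar_mx mulmxA mulmxDr.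
rewrite -[G *m A^T]opprK -AG mul_mx_scalar -mul_scalar_mx -mulNmx -mulmxDl.
rewrite -mulmxA IHk -scalemxAr mulmxA [(A - _) ^+ k.+1]exprS exprS mulN1r scaleNr.
by rewrite (_ : - A + _ = - (A - l%:M)) ?mulNmx ?scalerN // opprB addrC.
Qed.

Lemma skew_primary_space_orth (F : fieldType) (N m1 m2 : nat) (G A : 'M[F]_N)
    (p : {poly F}) (l m : F) (x : 'M[F]_(m1, N)) (y : 'M[F]_(m2, N)) :
  skew_for G A -> l + m != 0 ->
  (x <= primary_space A p l)%MS -> (y <= primary_space A p m)%MS ->
  x *m G *m y^T = 0.
Proof.
move=> AG lm /sub_kermxP xA /sub_kermxP yA.
have lm' : - l != m by rewrite eq_sym -subr_eq0 opprK addrC.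
have /Bezout_eq1_coprimepP[[u v] /= uvE] := coprimep_XsubCX (mup l p) (mup m p) lm'.
(* On the space of [m], [u(A)] inverts the power of [A + l]. Moved across [G], that power becomes,
   up to sign, the power of [A - l] that kills [x]. *)
have -> : y = y *m eval_mx A u *m (A + l%:M) ^+ mup l p.
  rewrite -[LHS]mulmx1 -(eval_mx1 A) -uvE [v * _]mulrC eval_mxD !eval_mxM !eval_mx_XsubCX.
  by rewrite mulmxDr !mulmxA yA mul0mx addr0 raddfN /= opprK.
rewrite trmx_mul -mulmxA (mulmxA G) (skew_for_pow _ _ AG) -scalemxAl -scalemxAr.
by rewrite !mulmxA xA !mul0mx scaler0.
Qed.

(** The rows chosen by [f] span the row space; by skewness the columns with the same indices have
    full rank too, so the principal submatrix [S] is invertible. In odd size skewness would give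
    [det S = - det S]. *)
Lemma skew_rank_even (F : numFieldType) (N : nat) (K : 'M[F]_N) :
  K^T = - K -> ~~ odd (\rank K).
Proof.
move=> Kskew; set f := maxrankfun K; set S := mxsub f f K.
have /submxP[D KE] : (K <= rowsub f K)%MS by rewrite eq_maxrowsub.
have rS : (\rank K <= \rank S)%N.
  have rK : \rank (colsub f K) = \rank K.
    rewrite -mxrank_tr trmx_mxsub Kskew.
    rewrite (_ : mxsub _ _ _ = - rowsub f K); last by apply/matrixP=> i j; rewrite !mxE.
    by rewrite mxrank_opp eq_maxrowsub.
  have cKE : colsub f K = D *m S.
    apply/matrixP => i j; have /matrixP/(_ i (f j)) := KE; rewrite !mxE => ->.
    by apply: eq_bigr => k _; rewrite !mxE.
  by rewrite -[X in (X <= _)%N]rK cKE mxrankM_maxr.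
have Su : S \in unitmx.
  by rewrite -row_free_unit /row_free eqn_leq rank_leq_row.
have ST : S^T = (-1) *: S.
  by rewrite scaleN1r trmx_mxsub Kskew; apply/matrixP => i j; rewrite !mxE.
apply/negP => rodd; move: Su; rewrite unitmxE unitfE => /negP; apply.
have /eqP := det_tr S; rewrite ST detZ -signr_odd rodd expr1 mulN1r.
by rewrite eq_sym -addr_eq0 -mulr2n mulrn_eq0.
Qed.

Lemma primary_space0_even (F : numFieldType) (N : nat) (G A : 'M[F]_N)
    (p : {poly F}) :
  G^T = G -> G \in unitmx -> skew_for G A -> p != 0 -> eval_mx A p = 0 ->
  odd (\rank (primary_space A p 0)) = odd N.
Proof.
(* The exponent is odd, which makes [A^k G] skew-symmetric, and at least the multiplicity of 0, so
   [A^k] has the generalized eigenspace as kernel. *)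
move=> GT Gu AG p0 pA; set k := ((mup 0 p).*2.+1)%N.
rewrite (primary_space_pow (k := k) p0 pA) /k; last first.
  by rewrite -addnn; apply: leqW; rewrite leq_addr.
rewrite mxrank_ker oddB ?rank_leq_row //.
rewrite raddf0 subr0 -[odd N in RHS]addbF; congr (_ (+) _); apply/negbTE.
rewrite -(mxrankMfree _ (B := G)) ?row_free_unit //; apply: skew_rank_even.
have := skew_for_pow 0 k AG; rewrite raddf0 addr0 subr0 -signr_odd /k /= odd_double /=.
by rewrite expr1 scaleN1r trmx_mul GT.
Qed.

(** * Direct sums, nondegeneracy and orthogonality of eigenspace pairs *)

Lemma primary_proj_sum (F : closedFieldType) (N : nat) (A : 'M[F]_N)
    (p : {poly F}) (e : F -> {poly F}) (s : seq F) :
  p != 0 -> eval_mx A p = 0 -> (forall l, is_eigenproj p l (e l)) -> uniq s ->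
  (forall x, (x \in s) = root p x) -> \sum_(l <- s) eval_mx A (e l) = 1%:M.
Proof.
move=> p0 pA pe s_uniq ps.
have /eqP := eval_mx_dvd (eigenproj_sum p0 pe s_uniq ps) pA.
by rewrite eval_mxB eval_mx1 eval_mx_sum subr_eq0 => /eqP.
Qed.

Lemma primary_proj_id (F : fieldType) (N m : nat) (A : 'M[F]_N)
    (p e : {poly F}) (l : F) (x : 'M[F]_(m, N)) :
  eval_mx A p = 0 -> is_eigenproj p l e -> (x <= primary_space A p l)%MS ->
  x *m eval_mx A e = x.
Proof. by move=> pA pe; rewrite (sub_primary_space _ pA pe) => /eqP. Qed.

Lemma primary_proj_0 (F : closedFieldType) (N k : nat) (A : 'M[F]_N)
    (p e f : {poly F}) (l m : F) (x : 'M[F]_(k, N)) :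
  p != 0 -> eval_mx A p = 0 -> is_eigenproj p l e -> is_eigenproj p m f ->
  l != m -> (x <= primary_space A p l)%MS -> x *m eval_mx A f = 0.
Proof.
move=> p0 pA pe pf lm xl; rewrite -(primary_proj_id pA pe xl) -mulmxA -eval_mxM.
by rewrite (eval_mx_dvd (eigenproj_orth p0 pe pf lm) pA) mulmx0.
Qed.

(** At [l = 0] both summands are the generalized eigenspace of 0, so results on pairs that allow
    [l = 0] also cover the zero summand. *)
Definition primary_pair (F : fieldType) (N : nat) (A : 'M[F]_N) (p : {poly F})
  (l : F) : 'M[F]_N := (primary_space A p l + primary_space A p (- l))%MS.

(** A common vector is both fixed and killed by [P]. For sums of generalized eigenspaces, [P] will
    be one eigenprojection or the sum of two. *)
Lemma capmx_proj0 (F : fieldType) (N m1 m2 : nat) (P : 'M[F]_N)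
    (X : 'M[F]_(m1, N)) (Y : 'M[F]_(m2, N)) :
  X *m P = X -> Y *m P = 0 -> (X :&: Y)%MS = 0.
Proof.
move=> XP YP; have /submxP[D XYE] := capmxSl X Y; have /submxP[C] := capmxSr X Y.
by rewrite XYE => /(congr1 (mulmx^~ P)); rewrite /= -!mulmxA XP YP mulmx0.
Qed.

Lemma oppr_neq (F : numFieldType) (l : F) : l != 0 -> l != - l.
Proof. by move=> l0; rewrite -addr_eq0 -mulr2n mulrn_eq0. Qed.

Lemma addsmx_mul0 (F : fieldType) (N m k : nat) (X1 X2 : 'M[F]_N)
    (P : 'M[F]_(N, k)) (x : 'M[F]_(m, N)) :
  X1 *m P = 0 -> X2 *m P = 0 -> (x <= X1 + X2)%MS -> x *m P = 0.
Proof.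
move=> P1 P2 xX; apply/sub_kermxP; apply: submx_trans xX _.
by rewrite addsmx_sub; apply/andP; split; apply/sub_kermxP.
Qed.

Lemma addsmx_proj_id (F : fieldType) (N m : nat) (X1 X2 P1 P2 : 'M[F]_N)
    (x : 'M[F]_(m, N)) :
  X1 *m P1 = X1 -> X2 *m P2 = X2 -> X1 *m P2 = 0 -> X2 *m P1 = 0 ->
  (x <= X1 + X2)%MS -> x *m (P1 + P2) = x.
Proof.
move=> P11 P22 P12 P21 xX; apply/eqP; rewrite -subr_eq0 -[X in _ - X]mulmx1 -mulmxBr.
apply/eqP; apply: addsmx_mul0 xX; rewrite mulmxBr mulmxDr mulmx1.
  by rewrite P11 P12 addr0 subrr.
by rewrite P21 P22 add0r subrr.
Qed.

Lemma primary_pair_proj_id (F : numClosedFieldType) (N k : nat) (A : 'M[F]_N)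
    (p : {poly F}) (e : F -> {poly F}) (l : F) (x : 'M[F]_(k, N)) :
  p != 0 -> eval_mx A p = 0 -> (forall l, is_eigenproj p l (e l)) -> l != 0 ->
  (x <= primary_pair A p l)%MS -> x *m (eval_mx A (e l) + eval_mx A (e (- l))) = x.
Proof.
move=> p0 pA pe l0; have lNl := oppr_neq l0.
have Nll : - l != l by rewrite eq_sym.
apply: addsmx_proj_id.
- exact: primary_proj_id pA (pe l) (submx_refl _).
- exact: primary_proj_id pA (pe (- l)) (submx_refl _).
- exact: primary_proj_0 p0 pA (pe l) (pe (- l)) lNl (submx_refl _).
- exact: primary_proj_0 p0 pA (pe (- l)) (pe l) Nll (submx_refl _).
Qed.

Lemma primary_pair_proj_0 (F : closedFieldType) (N k : nat) (A : 'M[F]_N)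
    (p : {poly F}) (e : F -> {poly F}) (l m : F) (x : 'M[F]_(k, N)) :
  p != 0 -> eval_mx A p = 0 -> (forall l, is_eigenproj p l (e l)) ->
  l != m -> l != - m -> (x <= primary_pair A p m)%MS -> x *m eval_mx A (e l) = 0.
Proof.
move=> p0 pA pe lm lNm; have ml : m != l by rewrite eq_sym.
have Nml : - m != l by rewrite eq_sym.
apply: addsmx_mul0.
- exact: primary_proj_0 p0 pA (pe m) (pe l) ml (submx_refl _).
- exact: primary_proj_0 p0 pA (pe (- m)) (pe l) Nml (submx_refl _).
Qed.

(** Presents the pair as the image of a single polynomial in [A], the form from which smooth frames
    are built. *)
Lemma primary_pairE (F : numClosedFieldType) (N : nat) (A : 'M[F]_N)
    (p : {poly F}) (e : F -> {poly F}) (l : F) :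
  p != 0 -> eval_mx A p = 0 -> (forall l, is_eigenproj p l (e l)) -> l != 0 ->
  (primary_pair A p l :=: eval_mx A (e l + e (- l)))%MS.
Proof.
move=> p0 pA pe l0; rewrite eval_mxD; apply/eqmxP/andP; split.
  rewrite -[X in (X <= _)%MS](primary_pair_proj_id p0 pA pe l0 (submx_refl _)).
  exact: submxMl.
apply: addmx_sub_adds; first by rewrite (primary_spaceE pA (pe l)).
by rewrite (primary_spaceE pA (pe (- l))).
Qed.

Lemma primary_pair_mxdirect (F : numClosedFieldType) (N : nat) (A : 'M[F]_N)
    (p : {poly F}) (l : F) :
  p != 0 -> eval_mx A p = 0 -> l != 0 ->
  mxdirect (primary_space A p l + primary_space A p (- l))%MS.
Proof.
move=> p0 pA l0; have [e pe] := eigenproj_exists p0.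
apply/mxdirect_addsP; apply: (@capmx_proj0 _ _ _ _ (eval_mx A (e l))).
  exact: primary_proj_id pA (pe l) (submx_refl _).
have Nll : - l != l by rewrite eq_sym oppr_neq.
exact: primary_proj_0 p0 pA (pe _) (pe _) Nll (submx_refl _).
Qed.

(** A vector of [E] orthogonal to [E] is orthogonal to the other generalized eigenspaces as well;
    together these span everything, and [G] is invertible. *)
Lemma skew_primary_space_nondeg (F : closedFieldType) (N m : nat) (G A : 'M[F]_N)
    (p : {poly F}) (l : F) (x : 'M[F]_(m, N)) :
  G \in unitmx -> skew_for G A -> p != 0 -> eval_mx A p = 0 ->
  let E := primary_pair A p l in
  (x <= E)%MS -> x *m G *m E^T = 0 -> x = 0.
Proof.
move=> Gu AG p0 pA E xE xG; have [e pe] := eigenproj_exists p0.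
have [s s_uniq ps] := closed_roots_seq p0.
have sumE := primary_proj_sum p0 pA pe s_uniq ps.
suff xG0 : x *m G = 0 by rewrite -[x](mulmxK Gu) xG0 mul0mx.
rewrite -[x *m G]mulmx1 -trmx1 -sumE linear_sum mulmx_sumr big1 // => r _ /=.
have er : (eval_mx A (e r) <= primary_space A p r)%MS.
  by rewrite (primary_spaceE pA (pe r)).
(* Either the image of [e r] lies in [E] and the hypothesis on [x] applies, or [r] is neither [l]
   nor [-l] and its space is orthogonal to [E]. *)
have [/submxP[D ->]|erE] := boolP (eval_mx A (e r) <= E)%MS.
  by rewrite trmx_mul mulmxA xG mul0mx.
have rl : r != l.
  by apply: contraNneq erE => rE; apply: submx_trans er _; rewrite rE addsmxSl.
have rNl : r != - l.
  by apply: contraNneq erE => rE; apply: submx_trans er _; rewrite rE addsmxSr.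
have lr : l + r != 0 by rewrite addrC addr_eq0.
have Nlr : - l + r != 0 by rewrite addrC subr_eq0.
rewrite -mulmxA; apply: addsmx_mul0 xE; rewrite mulmxA.
  exact: skew_primary_space_orth AG lr (submx_refl _) er.
exact: skew_primary_space_orth AG Nlr (submx_refl _) er.
Qed.

Lemma addsmx_form0 (F : fieldType) (N m1 m2 : nat) (G X1 X2 Y1 Y2 : 'M[F]_N)
    (x : 'M[F]_(m1, N)) (y : 'M[F]_(m2, N)) :
  X1 *m G *m Y1^T = 0 -> X1 *m G *m Y2^T = 0 ->
  X2 *m G *m Y1^T = 0 -> X2 *m G *m Y2^T = 0 ->
  (x <= X1 + X2)%MS -> (y <= Y1 + Y2)%MS -> x *m G *m y^T = 0.
Proof.
move=> XY11 XY12 XY21 XY22 xX /sub_addsmxP[[u v] /= ->].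
rewrite -mulmxA; apply: addsmx_mul0 xX.
  by rewrite linearD /= !trmx_mul !mulmxDr !mulmxA XY11 XY12 !mul0mx addr0.
by rewrite linearD /= !trmx_mul !mulmxDr !mulmxA XY21 XY22 !mul0mx addr0.
Qed.

(** None of the four sums of [l] or [-l] with [m] or [-m] is zero, so the summands are orthogonal
    one by one. *)
Lemma skew_primary_pair_orth (F : fieldType) (N m1 m2 : nat) (G A : 'M[F]_N)
    (p : {poly F}) (l m : F) (x : 'M[F]_(m1, N)) (y : 'M[F]_(m2, N)) :
  skew_for G A -> l != m -> l != - m ->
  (x <= primary_pair A p l)%MS -> (y <= primary_pair A p m)%MS ->
  x *m G *m y^T = 0.
Proof.
move=> AG lm lNm.
have H a b : a + b != 0 ->
    primary_space A p a *m G *m (primary_space A p b)^T = 0.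
  by move=> ab; exact: skew_primary_space_orth AG ab (submx_refl _) (submx_refl _).
apply: addsmx_form0; apply: H.
- by rewrite addr_eq0.
- by rewrite subr_eq0.
- by rewrite addrC subr_eq0 eq_sym.
- by rewrite -opprD oppr_eq0 addr_eq0.
Qed.

(** The projection onto one summand kills the others, which gives directness; the eigenprojections
    add up to the identity, which gives spanning. *)
Lemma primary_decomposition (F : numClosedFieldType) (N : nat) (A : 'M[F]_N)
    (p : {poly F}) (S : {fset F}) :
  p != 0 -> eval_mx A p = 0 ->
  (forall l, l \in S -> l != 0) ->
  (forall l m, l \in S -> m \in S -> l != - m) ->
  (forall l, root p l -> l != 0 -> l \in S \/ - l \in S) ->
  mxdirect (primary_space A p 0 + \sum_(l : S) (primary_pair A p (fsval l)))%MS /\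
  (primary_space A p 0 + \sum_(l : S) (primary_pair A p (fsval l)) :=: 1%:M)%MS.
Proof.
move=> p0 pA S0 SN pS; have [e pe] := eigenproj_exists p0.
split.
  rewrite mxdirect_addsE; apply/and3P; split.
  - exact: mxdirect_trivial.
  - apply/mxdirect_sumsE; split=> [l _|].
      exact: primary_pair_mxdirect p0 pA (S0 _ (fsvalP l)).
    apply/mxdirect_sumsP => l _.
    apply: (@capmx_proj0 _ _ _ _ (eval_mx A (e (fsval l)) + eval_mx A (e (- fsval l)))).
      exact: primary_pair_proj_id p0 pA pe (S0 _ (fsvalP l)) (submx_refl _).
    apply/sub_kermxP/sumsmx_subP => m ml; apply/sub_kermxP; rewrite mulmxDr.
    have lm : fsval l != fsval m by apply: contraNneq ml => /val_inj ->.
    have lNm : fsval l != - fsval m := SN _ _ (fsvalP l) (fsvalP m).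
    rewrite (primary_pair_proj_0 p0 pA pe lm lNm (submx_refl _)) add0r.
    apply: primary_pair_proj_0 p0 pA pe _ _ (submx_refl _).
      by rewrite eqr_oppLR.
    by rewrite eqr_opp.
  - apply/eqP; apply: (@capmx_proj0 _ _ _ _ (eval_mx A (e 0))).
      exact: primary_proj_id pA (pe 0) (submx_refl _).
    apply/sub_kermxP/sumsmx_subP => m _; apply/sub_kermxP.
    have m0 := S0 _ (fsvalP m).
    apply: primary_pair_proj_0 p0 pA pe _ _ (submx_refl _).
      by rewrite eq_sym.
    by rewrite eq_sym oppr_eq0.
have [s s_uniq ps] := closed_roots_seq p0.
apply/eqmxP; rewrite submx1 -(primary_proj_sum p0 pA pe s_uniq ps) big_seq /=.
apply: summx_sub => l; rewrite ps => pl.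
have El : (eval_mx A (e l) <= primary_space A p l)%MS.
  by rewrite (primary_spaceE pA (pe l)).
apply: submx_trans El _; have [->|l0] := eqVneq l 0; first exact: addsmxSl.
apply: submx_trans (addsmxSr _ _).
have [lS|lS] := pS l pl l0.
  by apply: (sumsmx_sup (FSetSub lS)) => //=; exact: addsmxSl.
by apply: (sumsmx_sup (FSetSub lS)) => //=; rewrite /primary_pair opprK; exact: addsmxSr.
Qed.

(** * Symmetric forms over an algebraically closed field *)

(** Induction on the size: complete a non-isotropic vector to a basis, clear its row and column,
    apply induction to the Schur complement, and scale by a square root. *)
Lemma sym_form_diag1 (F : numClosedFieldType) (m : nat) (S : 'M[F]_m) :
  S^T = S -> S \in unitmx -> exists Q : 'M[F]_m, Q *m S *m Q^T = 1%:M.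
Proof.
elim: m S => [|m IHm] S ST Su; first by exists 0; exact: mx00_eq.
have [v vS] : exists v : 'rV[F]_(1 + m), (v *m S *m v^T) 0 0 != 0.
  apply: contrapT => vS0.
  have vS (v : 'rV[F]_(1 + m)) : (v *m S *m v^T) 0 0 = 0.
    by apply/eqP; apply: contra_notT vS0 => vS; exists v.
  suff S0 : S = 0 by move: Su; rewrite S0 unitmxE det0 unitr0.
  have dE i j :
      ((delta_mx 0 i : 'rV_(1 + m)) *m S *m (delta_mx 0 j : 'rV_(1 + m))^T) 0 0 = S i j.
    by rewrite -rowE trmx_delta -colE !mxE.
  apply/matrixP => i j; rewrite mxE; apply/eqP.
  (* Polarization: at a sum of two basis vectors the vanishing form reduces to [2 S i j = 0]. *)
  have := vS (delta_mx 0 i + delta_mx 0 j).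
  rewrite linearD /= !mulmxDl !mulmxDr.
  have addE (X Y : 'M[F]_1) : (X + Y) 0 0 = X 0 0 + Y 0 0 by rewrite mxE.
  have Sji : S j i = S i j by rewrite -{1}ST mxE.
  by rewrite !addE !vS !dE Sji addr0 add0r -mulr2n => /eqP; rewrite mulrn_eq0.
(* [Q0] is invertible and [v] is a multiple of its first row [u], so [u] is not isotropic either. *)
set Q0 := row_ebase v; pose T : 'M[F]_(1 + m) := Q0 *m S *m Q0^T.
have Tu : T \in unitmx by rewrite !unitmx_mul unitmx_tr row_ebase_unit Su.
have TT : T^T = T by rewrite !trmx_mul trmxK ST mulmxA.
pose u := usubmx Q0 : 'rV[F]_(1 + m).
have sE : ulsubmx T = u *m S *m u^T.
  by rewrite /T -[Q0]vsubmxK tr_col_mx mul_col_mx mul_col_row block_mxKul.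
have s0 : ulsubmx T 0 0 != 0.
  apply: (contraNneq _ vS) => uSu.
  have rv : \rank v = 1%N.
    apply/eqP; rewrite eqn_leq rank_leq_row lt0n mxrank_eq0.
    by apply: contraNneq vS => ->; rewrite !mul0mx mxE.
  have -> : v = col_ebase v *m u.
    rewrite -[LHS](mulmx_ebase v) -/Q0 rv -mulmxA; congr (_ *m _).
    by rewrite (pid_mx_row _ m 1) -[Q0]vsubmxK mul_row_col mul1mx mul0mx addr0.
  rewrite trmx_mul !mulmxA -(mulmxA _ u) -(mulmxA _ (u *m S)) -sE.
  by rewrite [ulsubmx T]mx11_scalar uSu raddf0 mulmx0 mul0mx mxE.
set s := ulsubmx T 0 0 in s0; set b := ursubmx T; set d := drsubmx T.
have TE : T = block_mx s%:M b b^T d.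
  rewrite -[LHS]submxK -/b -/d [ulsubmx T]mx11_scalar -/s; congr block_mx.
  by rewrite /b trmx_ursub TT.
(* [L] is the elimination with pivot [s], and [d'] is the Schur complement. *)
pose L : 'M[F]_(1 + m) := block_mx 1%:M 0 (- s^-1 *: b^T) 1%:M.
pose d' := d - s^-1 *: (b^T *m b).
have LTL : L *m T *m L^T = block_mx s%:M 0 0 d'.
  rewrite TE /L tr_block_mx !mulmx_block !trmx1 trmx0 linearZ /= trmxK.
  rewrite !(mul0mx, mulmx0, mul1mx, mulmx1, addr0) mul_mx_scalar scalerA.
  rewrite mulrN mulfV // scaleN1r addNr !mul0mx !add0r mul_scalar_mx scalerA.
  by rewrite mulrN mulfV // scaleN1r addNr -scalemxAl scaleNr addrC.
have Lu : \det L = 1 by rewrite det_lblock !det1 mulr1.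
have d'u : d' \in unitmx.
  have : L *m T *m L^T \in unitmx.
    by rewrite unitmx_mul (unitmx_mul L) unitmx_tr Tu unitmxE Lu unitr1.
  by rewrite LTL !unitmxE det_ublock unitrM => /andP[].
have d'T : d'^T = d'.
  rewrite linearB linearZ /= trmx_mul trmxK; congr (_ - _).
  by rewrite /d trmx_drsub TT.
have [Q Qd] := IHm d' d'T d'u.
pose D : 'M[F]_(1 + m) := block_mx (sqrtC s)^-1%:M 0 0 Q.
exists (D *m L *m Q0).
have -> : D *m L *m Q0 *m S *m (D *m L *m Q0)^T = D *m (L *m T *m L^T) *m D^T.
  by rewrite /T !trmx_mul !mulmxA.
rewrite LTL /D tr_block_mx !mulmx_block !trmx0 !(mul0mx, mulmx0, addr0, add0r) Qd.
rewrite tr_scalar_mx -!scalar_mxM mulrAC -expr2 exprVn sqrtCK mulVf //.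
by rewrite -scalar_mx_block.
Qed.

(* Split an orthonormal basis of [E] into halves [U] and [D]: the two summands
   are spanned by the rows of [U + 'i D] and of [U - 'i D]. *)
Lemma even_isotropic_split (F : numClosedFieldType) (N : nat) (G E : 'M[F]_N) :
  G^T = G -> ~~ odd (\rank E) ->
  (forall x : 'rV_N, (x <= E)%MS -> x *m G *m E^T = 0 -> x = 0) ->
  exists A B : 'M[F]_N, [/\ A *m G *m A^T = 0, B *m G *m B^T = 0,
    mxdirect (A + B)%MS & (A + B :=: E)%MS].
Proof.
move=> GT rE Endeg; set k := (\rank E)./2.
have rk : \rank E = (k + k)%N by rewrite addnn -[LHS]odd_double_half (negbTE rE).
pose B0 := castmx (rk, erefl N) (row_base E).
have B0E : (B0 :=: E)%MS by apply: eqmx_trans (eqmx_cast _ _) (eq_row_base _).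
have B0f : row_free B0 by rewrite /row_free B0E rk.
pose S := B0 *m G *m B0^T.
have ST : S^T = S by rewrite /S !trmx_mul trmxK GT mulmxA.
(* A combination of basis rows killed by [S] is a vector of [E] orthogonal to [E]. *)
have Su : S \in unitmx.
  rewrite -row_free_unit -kermx_eq0; apply/rowV0P => y /sub_kermxP yS.
  apply: (row_free_inj B0f); rewrite mul0mx; apply: Endeg.
    by rewrite -B0E submxMl.
  have /submxP[D ->] : (E <= B0)%MS by rewrite B0E.
  by rewrite trmx_mul mulmxA -(mulmxA y) -(mulmxA y) yS mul0mx.
have [Q QS] := sym_form_diag1 ST Su.
have Qu : Q \in unitmx by have [] := mulmx1_unit (etrans (mulmxA _ _ _) QS).
pose C := Q *m B0.
have CE : (C :=: E)%MS.
  by apply: eqmx_trans B0E; apply: eqmxMfull; rewrite row_full_unit.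
have : C *m G *m C^T = 1%:M by rewrite -QS /S trmx_mul !mulmxA.
pose U := usubmx C; pose D := dsubmx C.
have CUD : C = col_mx U D by rewrite vsubmxK.
rewrite CUD tr_col_mx mul_col_mx mul_col_row scalar_mx_block.
move=> /eq_block_mx[UU UD DU DD].
(* Since the rows of [U] and [D] are jointly orthonormal, the rows of [U + c D] have Gram matrix
   [1 + c^2] times the identity. *)
have iso (c : F) : c ^+ 2 = -1 -> (U + c *: D) *m G *m (U + c *: D)^T = 0.
  move=> c2; rewrite linearD linearZ /= !mulmxDl !mulmxDr -!scalemxAl -!scalemxAr.
  by rewrite UU UD DU DD !scaler0 addr0 add0r scalerA -expr2 c2 scaleN1r subrr.
pose A1 := U + 'i *: D; pose A2 := U + (- 'i) *: D.
have i2 : 'i ^+ 2 = -1 :> F by rewrite sqrCi.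
have AE : (<<A1>> + <<A2>> :=: E)%MS.
  apply/eqmxP/andP; split.
    have UE : (U <= E)%MS by rewrite -CE CUD -addsmxE addsmxSl.
    have DE : (D <= E)%MS by rewrite -CE CUD -addsmxE addsmxSr.
    by rewrite addsmx_sub !genmxE !addmx_sub ?scalemx_sub.
  have A1s : (A1 <= <<A1>> + <<A2>>)%MS.
    by rewrite -[X in (X <= _)%MS]addr0 addmx_sub_adds ?genmxE ?sub0mx.
  have A2s : (A2 <= <<A1>> + <<A2>>)%MS.
    by rewrite -[X in (X <= _)%MS]add0r addmx_sub_adds ?genmxE ?sub0mx.
  have UA : 2 *: U = A1 + A2.
    by rewrite addrACA -scalerDl subrr scale0r addr0 scaler_nat mulr2n.
  have DA : (2 * 'i) *: D = A1 - A2.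
    by rewrite opprD addrACA subrr add0r -scalerBl opprK mulr_natl mulr2n.
  rewrite -CE CUD -addsmxE addsmx_sub.
  have n2 : 2 != 0 :> F by rewrite pnatr_eq0.
  rewrite -(eqmx_scale U n2) UA addmx_sub //.
  have n2i : 2 * 'i != 0 :> F by rewrite mulf_neq0 ?neq0Ci.
  by rewrite -(eqmx_scale D n2i) DA addmx_sub ?eqmx_opp.
have genI (X : 'M[F]_(k, N)) : X *m G *m X^T = 0 -> <<X>>%MS *m G *m (<<X>>%MS)^T = 0.
  have /submxP[Y ->] : (<<X>> <= X)%MS by rewrite genmxE.
  by move=> XX; rewrite trmx_mul !mulmxA -(mulmxA Y) -(mulmxA Y) XX mulmx0 mul0mx.
exists <<A1>>%MS, <<A2>>%MS; split=> //; try exact/genI/iso.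
  by apply/genI/iso; rewrite sqrrN.
(* Directness by counting: each summand has rank at most [k], and the sum has rank [k + k]. *)
rewrite mxdirectE /= AE rk eqn_leq -{1}rk -{1}AE mxrank_adds_leqif /=.
by rewrite !genmxE leq_add ?rank_leq_row.
Qed.

(** * Smooth fields of matrices *)

(** The first-order expansion of [f] at [x] is also one for [g], and the differential is unique. *)
Lemma near_eq_diff (R : numFieldType) (V W : normedModType R) (f g : V -> W) (x : V) :
  (\near x, f x = g x) -> differentiable f x ->
  differentiable g x /\ 'd g x = 'd f x :> (V -> W).
Proof.
move=> fg /diff_locallyP[dfc dfE].
have gE : g \o shift x = cst (g x) + 'd f x +o_ 0 id.
  apply/eqaddoP => e e0; have := dfE; move/eqaddoP => /(_ e e0).
  have fgx : f x = g x by exact: nbhs_singleton fg.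
  have : \forall h \near 0, f (h + x) = g (h + x).
    by move: fg; rewrite (near_shift 0 x); apply: filterS => h /=; rewrite subr0.
  by apply: filterS2 => h fgh; rewrite !fctE /= fgh fgx.
have dgE := diff_unique dfc gE; split; last exact: dgE.
by apply/diff_locallyP; rewrite dgE.
Qed.

(** On an open set, equality holds near each point and so passes to differentials. *)
Lemma class_C_ext (R : realType) (n : nat) (W : normedModType R) (k : nat)
    (V : set 'rV[R]_n) (f g : 'rV[R]_n -> W) :
  open V -> (forall x, V x -> f x = g x) -> class_C k V f -> class_C k V g.
Proof.
move=> oV; have nV x : V x -> \near x, V x by move=> Vx; exact: open_nbhs_nbhs.
elim: k f g => [|k IHk] f g fg.
  move=> fc x Vx; have fgx : \near x, f x = g x.
    by apply: filterS (nV x Vx) => y; exact: fg.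
  rewrite /prop_for /continuous_at -fg //.
  exact: cvg_trans (near_eq_cvg fgx) (fc x Vx).
have fgx x : V x -> \near x, f x = g x.
  by move=> Vx; apply: filterS (nV x Vx) => y; exact: fg.
move=> [fd fC]; split=> [x Vx|v].
  by have [] := near_eq_diff (fgx x Vx) (fd x Vx).
apply: IHk (fC v) => x Vx.
have [_ dgE] := near_eq_diff (fgx x Vx) (fd x Vx).
exact: (congr1 (fun h => h v) (esym dgE)).
Qed.

Lemma class_CS (R : realType) (n : nat) (W : normedModType R) (k : nat)
    (V : set 'rV[R]_n) (f : 'rV[R]_n -> W) :
  class_C k.+1 V f -> class_C k V f.
Proof.
elim: k f => [|k IHk] f [fd fC]; first by move=> x /fd/differentiable_continuous.
by split=> // v; apply: IHk (fC v).
Qed.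

Lemma class_C_subset (R : realType) (n : nat) (W : normedModType R) (k : nat)
    (V V' : set 'rV[R]_n) (f : 'rV[R]_n -> W) :
  V' `<=` V -> class_C k V f -> class_C k V' f.
Proof.
move=> VV; elim: k f => [|k IHk] f /=; first by move=> fc x /VV/fc.
by move=> [fd fC]; split=> [x /VV/fd//|v]; exact: IHk (fC v).
Qed.

Lemma class_C_cst (R : realType) (n : nat) (W : normedModType R) (k : nat)
    (V : set 'rV[R]_n) (c : W) : class_C k V (fun=> c).
Proof.
elim: k c => [|k IHk] c /=; first by move=> x _; exact: cst_continuous.
split=> [x _|v]; first exact: differentiable_cst.
rewrite (_ : (fun x => _) = fun=> 0) //; apply/funext => x.
by rewrite (_ : 'd _ x = 0 :> (_ -> _)) // (diff_cst _ x).
Qed.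

Lemma class_CD (R : realType) (n : nat) (W : normedModType R) (k : nat)
    (V : set 'rV[R]_n) (f g : 'rV[R]_n -> W) :
  open V -> class_C k V f -> class_C k V g -> class_C k V (fun x => f x + g x).
Proof.
move=> oV; elim: k f g => [|k IHk] f g /=.
  by move=> fc gc x Vx; exact: cvgD (fc x Vx) (gc x Vx).
move=> [fd fC] [gd gC]; split=> [x Vx|v].
  by exact: differentiableD (fd x Vx) (gd x Vx).
apply: class_C_ext (IHk _ _ (fC v) (gC v)) => // x Vx.
exact: (congr1 (fun h => h v) (esym (diffD (fd x Vx) (gd x Vx)))).
Qed.

Lemma class_CM (R : realType) (n : nat) (k : nat)
    (V : set 'rV[R]_n) (f g : 'rV[R]_n -> R) :
  open V -> class_C k V f -> class_C k V g -> class_C k V (fun x => f x * g x).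
Proof.
move=> oV; elim: k f g => [|k IHk] f g.
  by move=> fc gc x Vx; exact: cvgM (fc x Vx) (gc x Vx).
(* The Leibniz rule multiplies a differential by an undifferentiated factor, so [f] and [g] are also
   needed at class [k]. *)
move=> fC1 gC1; have [fC gC] := (class_CS fC1, class_CS gC1).
case: fC1 gC1 => [fd fC1] [gd gC1]; split=> [x Vx|v].
  by exact: differentiableM (fd x Vx) (gd x Vx).
apply: class_C_ext (class_CD oV (IHk _ _ fC (gC1 v)) (IHk _ _ gC (fC1 v))) => // x Vx.
exact: (congr1 (fun h => h v) (esym (diffM (fd x Vx) (gd x Vx)))).
Qed.

(** Tested on real and imaginary parts, in agreement with [smooth_csections], so that only real
    calculus is involved. *)
Definition csmooth_on (R : realType) (n : nat) (V : set 'rV[R]_n)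
    (f : 'rV[R]_n -> R[i]) : Prop :=
  smooth_on V (fun x => complex.Re (f x)) /\
  smooth_on V (fun x => complex.Im (f x)).

Lemma csmooth_cst (R : realType) (n : nat) (V : set 'rV[R]_n) (c : R[i]) :
  csmooth_on V (fun=> c).
Proof. by split=> k; exact: class_C_cst. Qed.

Lemma csmooth_ext (R : realType) (n : nat) (V : set 'rV[R]_n)
    (f g : 'rV[R]_n -> R[i]) :
  open V -> (forall x, V x -> f x = g x) -> csmooth_on V f -> csmooth_on V g.
Proof.
move=> oV fg [fr fi]; split=> k.
  by apply: class_C_ext (fr k) => // x /fg ->.
by apply: class_C_ext (fi k) => // x /fg ->.
Qed.

Lemma csmoothD (R : realType) (n : nat) (V : set 'rV[R]_n)
    (f g : 'rV[R]_n -> R[i]) :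
  open V -> csmooth_on V f -> csmooth_on V g -> csmooth_on V (fun x => f x + g x).
Proof.
move=> oV [fr fi] [gr gi]; split=> k.
  apply: class_C_ext (class_CD oV (fr k) (gr k)) => // x _.
  by case: (f x) (g x) => [? ?] [? ?].
apply: class_C_ext (class_CD oV (fi k) (gi k)) => // x _.
by case: (f x) (g x) => [? ?] [? ?].
Qed.

Lemma csmoothM (R : realType) (n : nat) (V : set 'rV[R]_n)
    (f g : 'rV[R]_n -> R[i]) :
  open V -> csmooth_on V f -> csmooth_on V g -> csmooth_on V (fun x => f x * g x).
Proof.
move=> oV [fr fi] [gr gi]; split=> k.
  have Nfg := class_CM oV (class_C_cst k V (-1 : R^o)) (class_CM oV (fi k) (gi k)).
  have := class_CD oV (class_CM oV (fr k) (gr k)) Nfg.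
  apply: class_C_ext => // x _.
  by case: (f x) (g x) => [? ?] [? ?] /=; rewrite mulN1r.
have := class_CD oV (class_CM oV (fr k) (gi k)) (class_CM oV (fi k) (gr k)).
apply: class_C_ext => // x _.
by case: (f x) (g x) => [? ?] [? ?].
Qed.

Lemma csmooth_sum (R : realType) (n : nat) (V : set 'rV[R]_n) (I : Type)
    (r : seq I) (P : pred I) (f : I -> 'rV[R]_n -> R[i]) :
  open V -> (forall i, csmooth_on V (f i)) ->
  csmooth_on V (fun x => \sum_(i <- r | P i) f i x).
Proof.
move=> oV fC; elim: r => [|i r IHr].
  by apply: csmooth_ext (csmooth_cst V 0) => // x _; rewrite big_nil.
case Pi: (P i); last by apply: csmooth_ext IHr => // x _; rewrite big_cons Pi.
by apply: csmooth_ext (csmoothD oV (fC i) IHr) => // x _; rewrite big_cons Pi.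
Qed.

Lemma csmooth_prod (R : realType) (n : nat) (V : set 'rV[R]_n) (I : Type)
    (r : seq I) (P : pred I) (f : I -> 'rV[R]_n -> R[i]) :
  open V -> (forall i, csmooth_on V (f i)) ->
  csmooth_on V (fun x => \prod_(i <- r | P i) f i x).
Proof.
move=> oV fC; elim: r => [|i r IHr].
  by apply: csmooth_ext (csmooth_cst V 1) => // x _; rewrite big_nil.
case Pi: (P i); last by apply: csmooth_ext IHr => // x _; rewrite big_cons Pi.
by apply: csmooth_ext (csmoothM oV (fC i) IHr) => // x _; rewrite big_cons Pi.
Qed.

Definition csmooth_mx (R : realType) (n m1 m2 : nat) (V : set 'rV[R]_n)
    (F : 'rV[R]_n -> 'M[R[i]]_(m1, m2)) : Prop :=
  forall i j, csmooth_on V (fun x => F x i j).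

Lemma csmooth_mx_cst (R : realType) (n m1 m2 : nat) (V : set 'rV[R]_n)
    (C : 'M[R[i]]_(m1, m2)) : csmooth_mx V (fun=> C).
Proof. by move=> i j; exact: csmooth_cst. Qed.

Lemma csmooth_mx_ext (R : realType) (n m1 m2 : nat) (V : set 'rV[R]_n)
    (F G : 'rV[R]_n -> 'M[R[i]]_(m1, m2)) :
  open V -> (forall x, V x -> F x = G x) -> csmooth_mx V F -> csmooth_mx V G.
Proof. by move=> oV FG FC i j; apply: csmooth_ext (FC i j) => // x /FG ->. Qed.

Lemma csmooth_mulmx (R : realType) (n m1 m2 m3 : nat) (V : set 'rV[R]_n)
    (F : 'rV[R]_n -> 'M[R[i]]_(m1, m2)) (G : 'rV[R]_n -> 'M[R[i]]_(m2, m3)) :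
  open V -> csmooth_mx V F -> csmooth_mx V G ->
  csmooth_mx V (fun x => F x *m G x).
Proof.
move=> oV FC GC i j.
have FGC k : csmooth_on V (fun x => F x i k * G x k j) by exact: csmoothM.
by apply: csmooth_ext (csmooth_sum _ xpredT oV FGC) => // x _; rewrite mxE.
Qed.

Lemma csmooth_eval_mx (R : realType) (n m : nat) (V : set 'rV[R]_n)
    (F : 'rV[R]_n -> 'M[R[i]]_m) (Q : {poly R[i]}) :
  open V -> csmooth_mx V F -> csmooth_mx V (fun x => eval_mx (F x) Q).
Proof.
move=> oV FC i j.
have FX k : csmooth_mx V (fun x => F x ^+ k).
  elim: k => [|k IHk]; first exact: csmooth_mx_cst.
  by apply: csmooth_mx_ext (csmooth_mulmx oV FC IHk) => // x _; rewrite exprS.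
have FQ (k : 'I_(size Q)) : csmooth_on V (fun x => Q`_k * (F x ^+ k) i j).
  exact: csmoothM (csmooth_cst _ _) (FX k i j).
apply: csmooth_ext (csmooth_sum _ xpredT oV FQ) => // x _.
by rewrite summxE; apply: eq_bigr => k _; rewrite mxE.
Qed.

Lemma csmooth_det (R : realType) (n m : nat) (V : set 'rV[R]_n)
    (F : 'rV[R]_n -> 'M[R[i]]_m) :
  open V -> csmooth_mx V F -> csmooth_on V (fun x => \det (F x)).
Proof.
move=> oV FC; apply: csmooth_sum => // s.
by apply: csmoothM => //; [exact: csmooth_cst | apply: csmooth_prod].
Qed.

Lemma csmooth_near_neq0 (R : realType) (n : nat) (V : set 'rV[R]_n)
    (f : 'rV[R]_n -> R[i]) (x : 'rV[R]_n) :
  csmooth_on V f -> V x -> f x != 0 -> \near x, f x != 0.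
Proof.
move=> [fr fi] Vx fx0.
have neq0 (g : 'rV[R]_n -> R) : {for x, continuous g} -> g x != 0 ->
    \near x, g x != 0.
  move=> gc gx; apply: (gc [set y : R | y != 0]).
  by apply: open_nbhs_nbhs; split=> //; exact: open_neq.
have := fx0; rewrite eq_complex negb_and => /orP[] fx.
  apply: filterS (neq0 _ (fr 0%N x Vx) fx) => y.
  by apply: contra_neq => ->.
apply: filterS (neq0 _ (fi 0%N x Vx) fx) => y.
by apply: contra_neq => ->.
Qed.

(** * Smooth frames of fields of idempotents *)

(** The chain rule for a composite equal to the identity near [x]; Jacobians act on rows, so the
    factor of [f] stands on the left. *)
Lemma jacobian_cancel (R : realType) (n : nat) (f g : 'rV[R]_n -> 'rV[R]_n)
    (x : 'rV[R]_n) :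
  differentiable f x -> differentiable g (f x) -> (\near x, g (f x) = x) ->
  'J f x *m 'J g (f x) = 1%:M.
Proof.
move=> fd gd gfx.
have idgf : \near x, id x = (g \o f) x by apply: filterS gfx => y /= ->.
have [_ dgf] := near_eq_diff idgf (is_diff_id x).(ex_diff).
have d1 v : 'd (g \o f) x v = v.
  by rewrite dgf -[RHS](congr1 (fun h => h v) (is_diff_id x).(diff_val)).
apply/row_matrixP => i; rewrite !rowE mulmx1 mulmxA /jacobian !mul_rV_lin1.
rewrite -[RHS]d1; exact: (congr1 (fun h => h _) (esym (diff_comp fd gd))).
Qed.

(** The Jacobian of the change of coordinates is inverted by that of the reverse change, and the
    contragredient block is then invertible too. *)
Lemma frame_unit (R : realType) (n : nat) (M : manifold R n)
    (a : chart R n M) (p : M) :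
  atlas a -> chart_dom a p -> frame a p \in unitmx.
Proof.
move=> aM ap; set c := chart_at p.
have cM : atlas c := chart_at_atlas p; have cp : chart_dom c p := chart_at_dom p.
have Tcp : transition c a (c p) = a p by rewrite /transition chart_mapK.
have d1 : differentiable (transition c a) (c p).
  by have [+ _] := transition_smooth cM aM 1; apply; exists p.
have d2 : differentiable (transition a c) (transition c a (c p)).
  by rewrite Tcp; have [+ _] := transition_smooth aM cM 1; apply; exists p.
suff JJ : 'J (transition c a) (c p) *m 'J (transition a c) (transition c a (c p)) = 1%:M.
  have [Ju _] := mulmx1_unit JJ.
  by rewrite /frame unitmxE det_ublock det_tr unitrM -!unitmxE unitmx_inv -/c Ju.
apply: jacobian_cancel => //.
(* The transitions cancel at points in the image of [c] whose preimage lies in the domain of [a];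
   both conditions hold near [c p]. *)
have nc : \forall x \near c p, (c @` chart_dom c) x.
  by apply: open_nbhs_nbhs; split; [exact: chart_codom_open | exists p].
have na : \forall x \near c p, chart_dom a (chart_inv c x).
  have na : nbhs (chart_inv c (c p)) (chart_dom a).
    by rewrite chart_mapK //; apply: open_nbhs_nbhs; split=> //; exact: chart_dom_open.
  exact: chart_inv_continuous cp _ na.
apply: filterS2 nc na => _ [q cq <-]; rewrite chart_mapK // => aq.
by rewrite /transition !chart_mapK.
Qed.

Lemma eqmx_rank_sub (F : fieldType) (m1 m2 N : nat) (A : 'M[F]_(m1, N))
    (B : 'M[F]_(m2, N)) :
  (A <= B)%MS -> (\rank B <= \rank A)%N -> (A :=: B)%MS.
Proof. by move=> AB BA; apply/eqmxP; rewrite -(geq_leqif (mxrank_leqif_eq AB)). Qed.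

(** [P (1 - P) = 0] bounds the sum of the ranks by [N], and [P + (1 - P) = 1] bounds it from
    below. *)
Lemma idempotent_rank (F : fieldType) (N : nat) (P : 'M[F]_N) :
  P *m P = P -> (\rank P + \rank (1%:M - P)%R = N)%N.
Proof.
move=> PP; apply/eqP; rewrite eqn_leq mulmx0_rank_max; last first.
  by rewrite mulmxBr mulmx1 PP subrr.
by rewrite -{1}(mxrank1 F N) -{1}(subrK P 1%:M) addnC mxrank_add.
Qed.

(* The two determinants are nonzero at [P = P0], so the conclusion holds for all
   idempotent [P] close to [P0]. *)
Lemma idempotent_frame (F : fieldType) (N : nat) (P0 P : 'M[F]_N) :
  let B0 := row_base P0 in let B1 := row_base (1%:M - P0) in
  P0 *m P0 = P0 -> P *m P = P ->
  \det (B0 *m P *m pinvmx B0) != 0 ->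
  \det (B1 *m (1%:M - P) *m pinvmx B1) != 0 ->
  row_free (B0 *m P) /\ (B0 *m P :=: P)%MS.
Proof.
move=> B0 B1 P00 PP d0 d1.
have r0 : (\rank P0 <= \rank (B0 *m P))%N.
  apply: leq_trans (mxrankM_maxl _ (pinvmx B0)).
  by move: d0; rewrite -unitfE -unitmxE -row_full_unit => /eqP ->.
have r1 : (\rank (1%:M - P0)%R <= \rank (1%:M - P)%R)%N.
  apply: leq_trans (mxrankM_maxr B1 _); apply: leq_trans (mxrankM_maxl _ (pinvmx B1)).
  by move: d1; rewrite -unitfE -unitmxE -row_full_unit => /eqP ->.
split; first by rewrite /row_free eqn_leq rank_leq_row.
apply: eqmx_rank_sub; first exact: submxMl.
(* The ranks of [P] and [1 - P] add up to [N], as do those at [P0]; hence the lower bound for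
   [1 - P] is an upper bound for [P]. *)
apply: leq_trans r0; rewrite -(leq_add2r (\rank (1%:M - P)%R)) (idempotent_rank PP).
by rewrite -[X in (X <= _)%N](idempotent_rank P00) leq_add2l.
Qed.

Lemma idempotent_frame_det (F : fieldType) (N : nat) (P0 : 'M[F]_N) :
  P0 *m P0 = P0 -> \det (row_base P0 *m P0 *m pinvmx (row_base P0)) = 1.
Proof.
move=> P00; have /submxP[D B0E] : (row_base P0 <= P0)%MS by rewrite eq_row_base.
have -> : row_base P0 *m P0 = row_base P0 by rewrite B0E -mulmxA P00.
by rewrite mulmxVp ?row_base_free // det1.
Qed.

Lemma map_Re_mulmx (R : rcfType) (m1 m2 m3 : nat) (A : 'M[R[i]]_(m1, m2))
    (B : 'M[R]_(m2, m3)) :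
  map_mx (@complex.Re R) (A *m map_mx (real_complex R) B) =
  map_mx (@complex.Re R) A *m B.
Proof.
apply/matrixP => i j; rewrite !mxE raddf_sum; apply: eq_bigr => k _ /=.
by rewrite !mxE; case: (A i k) => [? ?] /=; rewrite mulr0 subr0.
Qed.

Lemma map_Im_mulmx (R : rcfType) (m1 m2 m3 : nat) (A : 'M[R[i]]_(m1, m2))
    (B : 'M[R]_(m2, m3)) :
  map_mx (@complex.Im R) (A *m map_mx (real_complex R) B) =
  map_mx (@complex.Im R) A *m B.
Proof.
apply/matrixP => i j; rewrite !mxE raddf_sum; apply: eq_bigr => k _ /=.
by rewrite !mxE; case: (A i k) => [? ?] /=; rewrite mulr0 add0r.
Qed.

Lemma csmooth_mx_map (R : realType) (n m1 m2 : nat) (V : set 'rV[R]_n)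
    (F : 'rV[R]_n -> 'M[R]_(m1, m2)) :
  (forall i j, smooth_on V (fun x => F x i j)) ->
  csmooth_mx V (fun x => map_mx (real_complex R) (F x)).
Proof.
move=> FC i j; rewrite /csmooth_on; split=> k.
  rewrite (_ : (fun x => _) = fun x => F x i j); first exact: FC.
  by apply/funext=> x; rewrite mxE.
rewrite (_ : (fun x => _) = fun=> 0); first exact: class_C_cst.
by apply/funext=> x; rewrite mxE.
Qed.

Lemma csmooth_idempotent_frame (R : realType) (n N : nat) (V : set 'rV[R]_n)
    (P : 'rV[R]_n -> 'M[R[i]]_N) (x0 : 'rV[R]_n) :
  open V -> V x0 -> csmooth_mx V P -> (forall x, V x -> P x *m P x = P x) ->
  exists (k : nat) (B : 'M[R[i]]_(k, N)),
    \near x0, row_free (B *m P x0) /\ (B *m P x0 :=: P x0)%MS.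
Proof.
move=> oV Vx0 PC PP; have P00 := PP _ Vx0.
have P01 : (1%:M - P x0) *m (1%:M - P x0) = 1%:M - P x0.
  by rewrite mulmxBr mulmx1 mulmxBl mul1mx P00 subrr subr0.
have NPC : csmooth_mx V (fun x => 1%:M - P x).
  move=> i j; have NP := csmoothM oV (csmooth_cst V (-1)) (PC i j).
  have := csmoothD oV (csmooth_cst V ((1%:M : 'M[R[i]]_N) i j)) NP.
  apply: csmooth_ext => // x _; rewrite mulN1r [RHS]mxE; congr (_ + _).
  by rewrite [RHS]mxE.
have nearD m (B : 'M[R[i]]_(m, N)) C (F : 'rV[R]_n -> 'M[R[i]]_N) :
    csmooth_mx V F -> \det (B *m F x0 *m C) = 1 -> \near x0, \det (B *m F x0 *m C) != 0.
  move=> FC F1; apply: (csmooth_near_neq0 (V := V)) => //; last by rewrite F1 oner_eq0.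
  have BF := csmooth_mulmx oV (csmooth_mx_cst V B) FC.
  exact: csmooth_det oV (csmooth_mulmx oV BF (csmooth_mx_cst V C)).
have nV : \near x0, V x0 by exact: open_nbhs_nbhs.
(* The constant matrix [B] is a basis of the image at [x0]; nearby, the rows of [B *m P x] are a
   basis of the image at [x]. *)
exists (\rank (P x0)), (row_base (P x0)).
apply: filterS3 nV (nearD _ _ _ _ PC (idempotent_frame_det P00))
  (nearD _ _ _ _ NPC (idempotent_frame_det P01)) => x Vx.
exact: idempotent_frame P00 (PP x Vx).
Qed.

Lemma idempotent_conj (F : fieldType) (N : nat) (G P : 'M[F]_N) :
  G \in unitmx -> P *m P = P ->
  (invmx G *m P *m G) *m (invmx G *m P *m G) = invmx G *m P *m G.
Proof. by move=> Gu PP; rewrite !mulmxA mulmxK // -(mulmxA _ P P) PP. Qed.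

(** In chart coordinates the matrix of [phi] is smooth, hence so is the idempotent obtained by
    evaluating [Q] at it. A local frame of its image is built there and carried back to the fibers
    by the inverse of [frame]. *)
Lemma subbundle_eval_mx (R : realType) (n : nat) (M : manifold R n)
    (phi : M -> 'M[R]_(n + n)) (Q : {poly R[i]})
    (E : M -> 'M[R[i]]_(n + n)) :
  let cphi p := map_mx (real_complex R) (phi p) in
  smooth_endo phi ->
  (forall p, eval_mx (cphi p) Q *m eval_mx (cphi p) Q = eval_mx (cphi p) Q) ->
  (forall p, (E p :=: eval_mx (cphi p) Q)%MS) -> subbundle E.
Proof.
move=> cphi phiC Qidem EQ p0.
have [a [aM ap0 [V [oV Va] psiC]]] := phiC p0.
pose cframe p := map_mx (real_complex R) (frame a p).
pose psi x := let q := chart_inv a x in invmx (frame a q) *m phi q *m frame a q.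
have [Pi PiE'] : exists Pi : 'rV[R]_n -> 'M[R[i]]_(n + n),
    Pi = fun x => eval_mx (map_mx (real_complex R) (psi x)) Q by eexists.
pose W := V `&` (a @` chart_dom a).
have oW : open W by apply: openI => //; exact: chart_codom_open.
have PiC : csmooth_mx W Pi.
  rewrite PiE'; apply: csmooth_eval_mx => //; apply: csmooth_mx_map => i j k.
  by apply: class_C_subset (psiC i j k) => x [].
have fru p : chart_dom a p -> cframe p \in unitmx.
  by move=> ap; rewrite map_unitmx frame_unit.
have PiE p : chart_dom a p ->
    Pi (a p) = invmx (cframe p) *m eval_mx (cphi p) Q *m cframe p.
  move=> ap; rewrite PiE' /psi chart_mapK // !map_mxM map_invmx.
  by rewrite eval_mx_conj // fru.
have PiI x : W x -> Pi x *m Pi x = Pi x.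
  move=> [_ [p ap <-]]; rewrite (PiE p ap).
  have := idempotent_conj (fru p ap) (Qidem p); exact.
have Wap0 : W (a p0) by split=> //; exists p0.
have [k [B nearB]] := csmooth_idempotent_frame oW Wap0 PiC PiI.
pose U := [set p | chart_dom a p /\
  [/\ V (a p), row_free (B *m Pi (a p)) & (B *m Pi (a p) :=: Pi (a p))%MS]].
exists k, (fun p => B *m Pi (a p) *m map_mx (real_complex R) (invmx (frame a p))).
(* The good points contain a neighborhood of [p0]; the interior supplies an open one. *)
exists (interior U); split.
  split; first exact: open_interior.
  have na : \forall p \near p0, chart_dom a p.
    by apply: open_nbhs_nbhs; split=> //; exact: chart_dom_open.
  have nV : \forall x \near a p0, V x by exact: open_nbhs_nbhs.
  apply: filterS3 na (chart_map_continuous ap0 nV) (chart_map_continuous ap0 nearB).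
  by move=> p ap Vp [].
move=> p /interior_subset[ap [Vap free_s eq_s]].
have iu : map_mx (real_complex R) (invmx (frame a p)) \in unitmx.
  by rewrite map_unitmx unitmx_inv frame_unit.
split.
- by rewrite /row_free mxrankMfree ?row_free_unit.
- apply: eqmx_trans (eqmx_sym (EQ p)); apply: eqmx_rank_sub.
    by rewrite PiE // !mulmxA map_invmx mulmxK ?fru //; exact: submxMl.
  rewrite mxrankMfree ?row_free_unit // eq_s PiE //.
  rewrite mxrankMfree ?row_free_unit ?fru // eqmxMfull // row_full_unit.
  by rewrite unitmx_inv fru.
(* [h] stands for the real or the imaginary part; both commute with right multiplication by the real
   matrices [frame a q]. *)
have smooth_part (h : R[i] -> R) :
    (forall (A : 'M[R[i]]_(k, n + n)) (C : 'M[R]_(n + n)),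
      map_mx h (A *m map_mx (real_complex R) C) = map_mx h A *m C) ->
    (forall i j, smooth_on W (fun x => h ((B *m Pi x) i j))) ->
  smooth_sections (fun q => map_mx h
    (B *m Pi (a q) *m map_mx (real_complex R) (invmx (frame a q)))) p.
  move=> hM hC; exists a; split=> //; exists W.
    by split=> //; split=> //; exists p.
  move=> i j l; apply: class_C_ext (hC i j l) => // _ [_ [q aq <-]].
  by rewrite chart_mapK // -hM map_invmx mulmxKV ?fru // [RHS]mxE.
have BPiC := csmooth_mulmx oW (csmooth_mx_cst W B) PiC.
split.
  apply: (smooth_part (@complex.Re R)) => [A C|i j]; first exact: map_Re_mulmx.
  by case: (BPiC i j).
apply: (smooth_part (@complex.Im R)) => [A C|i j]; first exact: map_Im_mulmx.
by case: (BPiC i j).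
Qed.

(** * Decomposition of the complexified generalized tangent bundle *)

Lemma is_minpoly_cpoly (R : realType) (N : nat) (A : 'M[R]_N) (P : {poly R}) :
  is_minpoly A P -> eval_mx (map_mx (real_complex R) A) (cpoly P) = 0.
Proof. by move=> [_ PA _]; rewrite eval_mx_map PA map_mx0. Qed.

Theorem theorem45 (R : realType) (n : nat) (M : manifold R n)
    (phi : M -> 'M[R]_(n + n)) (P : {poly R})
    (hphi : generalized_polynomial_structure phi P) :
  let L := eigenbundle phi P in
  let E := eigenbundle_pair phi P in
  [/\ (forall l : R[i], spectrum P l -> l <> 0 -> isotropic_bundle (L l)),
      (forall l : R[i], spectrum P l -> l <> 0 ->
         (forall p : M, mxdirect (L l p + L (- l) p)%MS) /\
         quasi_split (E l)),
      quasi_split (L 0) &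
      forall S : {fset R[i]}, half_spectrum P S ->
        forall p : M,
          [/\ mxdirect (L 0 p + \sum_(l : S) E (fsval l) p)%MS,
              (L 0 p + \sum_(l : S) E (fsval l) p :=: 1%:M)%MS,
              (forall l : R[i], l \in S -> orthogonal_mx (L 0 p) (E l p)) &
              (forall l m : R[i], l \in S -> m \in S -> l != m ->
                 orthogonal_mx (E l p) (E m p))]].
Proof.
move=> L E; case: hphi => phiC phi_skew Pmon _ Pmin.
pose p := cpoly P; pose A q := map_mx (real_complex R) (phi q); pose G := gram R[i] n.
have p0 : p != 0 by rewrite map_poly_eq0 monic_neq0.
have pA q : eval_mx (A q) p = 0 by exact: is_minpoly_cpoly.
have AG q : skew_for G (A q).
  by rewrite /G -(map_gram (real_complex R)); apply/skew_for_map/skew_for_inner.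
have GT : G^T = G := gram_sym _ n.
have Gu : G \in unitmx := gram_unit _ n.
have [e pe] := eigenproj_exists p0.
have idem Q q : (forall x : 'M[R[i]]_(n + n),
    (x <= eval_mx (A q) Q)%MS -> x *m eval_mx (A q) Q = x) ->
  eval_mx (A q) Q *m eval_mx (A q) Q = eval_mx (A q) Q by apply.
(* [e l] is chosen from [p] alone, so one polynomial gives the projection at all points; [l = 0] is
   included. *)
have subL l : subbundle (L l).
  apply: (subbundle_eval_mx (Q := e l) phiC) => q;
    last exact: primary_spaceE (pA q) (pe l).
  apply: idem => x; rewrite -(primary_spaceE (pA q) (pe l)).
  exact: primary_proj_id (pA q) (pe l).
have subE l : l != 0 -> subbundle (E l).
  move=> l0; apply: (subbundle_eval_mx (Q := e l + e (- l)) phiC) => q.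
    apply: idem => x; rewrite -(primary_pairE p0 (pA q) pe l0) eval_mxD.
    exact: primary_pair_proj_id p0 (pA q) pe l0.
  exact: primary_pairE p0 (pA q) pe l0.
have orthL l m q : l + m != 0 -> orthogonal_mx (L l q) (L m q).
  move=> lm; apply/orthogonal_mxP.
  exact: skew_primary_space_orth (AG q) lm (submx_refl _) (submx_refl _).
have isoL l q : l != 0 -> isotropic_mx (L l q).
  by move=> l0; apply: orthL; rewrite -mulr2n mulrn_eq0.
have dirE l q : l != 0 -> mxdirect (L l q + L (- l) q)%MS.
  by move=> l0; exact: primary_pair_mxdirect p0 (pA q) l0.
have nondegE l q (x : 'rV[R[i]]_(n + n)) : (x <= primary_pair (A q) p l)%MS ->
    x *m G *m (primary_pair (A q) p l)^T = 0 -> x = 0.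
  exact: skew_primary_space_nondeg Gu (AG q) p0 (pA q).
have nondeg_mx (B : 'M[R[i]]_(n + n)) :
    (forall x : 'rV[R[i]]_(n + n), (x <= B)%MS -> x *m G *m B^T = 0 -> x = 0) ->
  nondegenerate_mx B.
  move=> Bnd x xB xG; apply: Bnd => //; apply/rowP => j; rewrite [RHS]mxE.
  rewrite -(xG _ (row_sub j B)) innerE tr_row [RHS]mxE [LHS]mxE.
  by apply: eq_bigr => k _; congr (_ * _); rewrite [RHS]mxE.
have pair0 q : (primary_pair (A q) p 0 :=: L 0 q)%MS.
  by rewrite /primary_pair oppr0; exact: addsmx_idPl.
have nondegL0 q (x : 'rV[R[i]]_(n + n)) : (x <= L 0 q)%MS ->
    x *m G *m (L 0 q)^T = 0 -> x = 0.
  move=> xL xG; apply: (nondegE 0 q); first by rewrite pair0.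
  have /submxP[D ->] : (primary_pair (A q) p 0 <= L 0 q)%MS by rewrite pair0.
  by rewrite trmx_mul mulmxA xG mul0mx.
split.
- by move=> l _ /eqP l0; split=> // q; exact: isoL.
- move=> l _ /eqP l0; split=> [q|]; first exact: dirE.
  split; first exact: subE.
    by move=> q; apply: nondeg_mx => x; exact: nondegE.
  move=> q; exists (L l q), (L (- l) q); split=> //.
  + exact: isoL.
  + by apply: isoL; rewrite oppr_eq0.
  + exact: dirE.
- split=> // q; first by apply: nondeg_mx; exact: nondegL0.
  (* The fiber has even dimension [n + n], and the dimension of [L 0] has the same parity. *)
  have rL0 : ~~ odd (\rank (L 0 q)).
    by rewrite (primary_space0_even GT Gu (AG q) p0 (pA q)) addnn odd_double.
  have [B [C [BG CG dBC BC]]] := even_isotropic_split GT rL0 (nondegL0 q).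
  exists B, C; split; [exact/orthogonal_mxP | exact/orthogonal_mxP | |].
    exact: dBC.
  exact: BC.
- move=> S [Sspec SS] q.
  (* [half_spectrum] is turned into the three conditions of the decomposition: no zero, no two
     opposite elements, and every nonzero root up to sign. *)
  have S0 l : l \in S -> l != 0.
    move=> lS; have [_ /eqP //] : (spectrum P `\ 0) l by rewrite -Sspec; left.
  have SN l m : l \in S -> m \in S -> l != - m.
    move=> lS mS; apply/eqP => lm.
    suff : (set0 : set R[i]) l by [].
    by rewrite -SS; split=> //; exists m.
  have pS l : root p l -> l != 0 -> l \in S \/ - l \in S.
    move=> pl /eqP l0; have : (spectrum P `\ 0) l by [].
    by rewrite -Sspec => -[lS|[m mS <-]]; [left | right; rewrite opprK].
  have [dirS sumS] := primary_decomposition p0 (pA q) S0 SN pS.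
  split=> // [l lS|l m lS mS lm].
    apply/orthogonal_mxP.
    (* [L 0] is treated as the pair of 0, so the orthogonality of pairs applies. *)
    have l0 : 0 != l by rewrite eq_sym S0.
    have l0' : 0 != - l by rewrite eq_sym oppr_eq0 S0.
    apply: (skew_primary_pair_orth (AG q) l0 l0' _ (submx_refl _)).
    by rewrite pair0.
  apply/orthogonal_mxP.
  exact: skew_primary_pair_orth (AG q) lm (SN _ _ lS mS) (submx_refl _) (submx_refl _).
Qed.
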